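(* Let $L_1=L_1([0,1],\mu)$ with $\mu$ Lebesgue measure. The norm of $FBL[L_1]$ fails the Fatou property; that is, there is an upwards directed set $\mathcal F\subseteq FBL[L_1]_+$ having a supremum $y\in FBL[L_1]$ with $\sup\{\|x\|:x\in\mathcal F\}\ne\|y\|$.
   Context: For a real Banach space $E$ with dual $E^*$ and closed unit ball $B_E$, let $H[E]$ be the vector space of all positively homogeneous functions $f:E^*\to\mathbb R$ ($f(\lambda x^* )=\lambda f(x^* )$ for $\lambda>0$). For $f\in H[E]$ put $\|f\|_{FBL[E]}:=\sup\{\sum_{k=1}^n|f(x_k^* )| : n\in\mathbb N,\ x_1^*,\dots,x_n^*\in E^*,\ \sup_{x\in B_E}\sum_{k=1}^n|x_k^*(x)|\le 1\}$. $H_0[E]:=\{f\in H[E]:\|f\|_{FBL[E]}<\infty\}$ is a Banach lattice with this norm and pointwise order/operations. For $x\in E$ let $\delta_x(x^* )=x^*(x)$. $FBL[E]$ is the closed sublattice of $H_0[E]$ generated by $\{\delta_x:x\in E\}$. The norm of a Banach lattice $X$ has the Fatou property if whenever an upwards directed set $\mathcal F\subseteq X_+$ has a supremum $y$ in $X$, then $\sup\{\|x\|:x\in\mathcal F\}=\|y\|$. *)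

(* Defs.v *)
From HB Require Import structures.
From mathcomp Require Import all_boot all_order all_algebra.
From mathcomp Require Import all_classical all_reals all_analysis.
Set Implicit Arguments. Unset Strict Implicit. Unset Printing Implicit Defensive.
Import Order.TTheory GRing.Theory Num.Theory.
Local Open Scope classical_set_scope.
Local Open Scope ring_scope.

Section FBL.
Variables (R : realType) (E : lmodType R) (nE : E -> R).

Definition is_dual (phi : E -> R) : Prop :=
  (forall (a : R) (x y : E), phi (a *: x + y) = a * phi x + phi y) /\
  exists C : R, forall x : E, `|phi x| <= C * nE x.

Definition dualT := {phi : E -> R | is_dual phi}.

Definition pos_hom (f : dualT -> R) : Prop :=
  forall (l : R) (xs ys : dualT), 0 < l ->
    (forall x, sval ys x = l * sval xs x) -> f ys = l * f xs.

Definition fbl_norm (f : dualT -> R) : \bar R :=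
  ereal_sup [set r : \bar R | exists (n : nat) (xs : 'I_n -> dualT),
     (forall x : E, nE x <= 1 -> \sum_(k < n) `|sval (xs k) x| <= 1) /\
     r = (\sum_(k < n) `|f (xs k)|)%:E].

Definition H0 (f : dualT -> R) : Prop := pos_hom f /\ (fbl_norm f < +oo)%E.

Definition delta (x : E) : dualT -> R := fun xs => sval xs x.

Definition closed_sublattice_with_deltas (S : set (dualT -> R)) : Prop :=
  [/\ S `<=` H0,
      forall x : E, S (delta x),
      (forall f g, S f -> S g -> S (fun xs => f xs + g xs)) /\
      (forall (a : R) f, S f -> S (fun xs => a * f xs)),
      forall f g, S f -> S g -> S (fun xs => Num.max (f xs) (g xs)) &
      forall f, H0 f ->
        (forall e : R, 0 < e -> exists g, S g /\
           (fbl_norm (fun xs => (f xs - g xs)%R) < e%:E)%E) -> S f].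

Definition FBL (f : dualT -> R) : Prop :=
  forall S, closed_sublattice_with_deltas S -> S f.

Definition fle (f g : dualT -> R) : Prop := forall xs, f xs <= g xs.

End FBL.
Arguments FBL {R E} nE f.

Section L1.
Variable R : realType.

Definition mu01 : {measure set (measurableTypeR R) -> \bar R} :=
  mrestr (@lebesgue_measure R) (@measurable_itv R `[(0:R), 1]).

Definition L1 := LfunType mu01 (@lexx _ _ 1%E).

Definition L1norm (f : L1) : R := fine ('N[mu01]_1%E[EFin \o (f : R -> R)]).

End L1.

(* Main.v *)
(* Elements of [FBL[L_1]] are continuous along bounded weakly-* convergent
   sequences of functionals, because the functions with this property form a
   closed sublattice containing the evaluations. Let [y = |delta_1|], of norm at
   least 1, and [f_n = min (y, 1/2 \sum_i |delta_(1_(I_i))|)], where [I_i] runs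
   over the [2^n] dyadic intervals of length [2^-n]. The [f_n] increase with [n]
   and have norm at most [1/2]. If [z >= f_n] for all [n], then [z >= y]: adding to
   a functional [phi] a large multiple [M] of the Rademacher functional
   [x |-> \int x r_n] makes the sum in [f_n] exceed [y], whereas these functionals
   tend weakly-* to 0 (Riemann-Lebesgue), so [z phi >= y phi] in the limit. *)
Require Import Defs.
From HB Require Import structures.
From mathcomp Require Import all_boot all_order all_algebra.
From mathcomp Require Import all_classical all_reals all_analysis.
From mathcomp Require Import measurable_realfun ring lra.
Set Implicit Arguments. Unset Strict Implicit. Unset Printing Implicit Defensive.
Import Order.TTheory GRing.Theory Num.Theory.
Import numFieldNormedType.Exports.
Local Open Scope classical_set_scope.
Local Open Scope ring_scope.

(** * The norm of FBL[E], its lattice operations, and sequential weak-* continuity *)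

Section FreeBanachLattice.
Context {R : realType} {E : lmodType R} (nE : E -> R).
Implicit Types (f g : dualT nE -> R) (phi psi : dualT nE) (x y : E).

Lemma dual0 phi : sval phi 0 = 0.
Proof.
have := (svalP phi).1 1 0 0.
by rewrite scaler0 addr0 mul1r -{1}[sval phi 0]addr0 => /addrI.
Qed.

Lemma dualD phi x y : sval phi (x + y) = sval phi x + sval phi y.
Proof. by have := (svalP phi).1 1 x y; rewrite scale1r mul1r. Qed.

Lemma dualZ phi (a : R) x : sval phi (a *: x) = a * sval phi x.
Proof. by have := (svalP phi).1 a x 0; rewrite !addr0 dual0 addr0. Qed.

Lemma is_dual_addscale phi (a : R) psi :
  is_dual nE (fun x => sval phi x + a * sval psi x).
Proof.
have [[phiL [C phiC]] [psiL [D psiD]]] := (svalP phi, svalP psi).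
split=> [b x y|]; first by rewrite phiL psiL; ring.
exists (C + `|a| * D) => x; rewrite (le_trans (ler_normD _ _))// normrM mulrDl.
by rewrite lerD// -mulrA ler_wpM2l.
Qed.

Definition dual_addscale phi a psi : dualT nE :=
  exist _ _ (is_dual_addscale phi a psi).

Lemma is_dual_scale (a : R) phi : is_dual nE (fun x => a * sval phi x).
Proof.
have [phiL [C phiC]] := svalP phi.
split=> [b x y|]; first by rewrite phiL; ring.
by exists (`|a| * C) => x; rewrite normrM -mulrA ler_wpM2l.
Qed.

Definition dual_scale a phi : dualT nE := exist _ _ (is_dual_scale a phi).

Definition admissible n (phi : 'I_n -> dualT nE) :=
  forall x, nE x <= 1 -> \sum_(k < n) `|sval (phi k) x| <= 1.

Lemma fbl_norm_ge f n (phi : 'I_n -> dualT nE) : admissible phi ->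
  ((\sum_(k < n) `|f (phi k)|)%:E <= fbl_norm f)%E.
Proof. by move=> phiA; apply: ereal_sup_ubound; exists n, phi. Qed.

Lemma fbl_norm_le f (c : \bar R) :
  (forall n (phi : 'I_n -> dualT nE), admissible phi ->
    ((\sum_(k < n) `|f (phi k)|)%:E <= c)%E) -> (fbl_norm f <= c)%E.
Proof. by move=> fc; apply: ge_ereal_sup => _ [n [phi [phiA ->]]]; exact: fc. Qed.

(** Finiteness of the norm in terms of real numbers, so that bounds combine without extended-real
    arithmetic. *)
Definition fbl_bounded f := exists C : R, forall n (phi : 'I_n -> dualT nE),
  admissible phi -> \sum_(k < n) `|f (phi k)| <= C.

Lemma fbl_boundedP f : (fbl_norm f < +oo)%E <-> fbl_bounded f.
Proof.
split=> [foo|[C fC]]; last first.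
  by apply: (@le_lt_trans _ _ C%:E); [apply: fbl_norm_le => *; rewrite lee_fin fC
                                     |exact: ltry].
exists (fine (fbl_norm f)) => n phi phiA.
have := fbl_norm_ge f phiA; rewrite -[X in (_ <= X)%E]fineK ?lee_fin//.
rewrite fin_numElt foo andbT (lt_le_trans (ltNyr 0))//.
(* The empty family contributes the value 0, so the supremum is not [-oo]. *)
by apply: ereal_sup_ubound; exists 0%N, (fun i => phi (widen_ord (leq0n n) i));
  split=> [*|]; rewrite big_ord0.
Qed.

Lemma fbl_boundedW f g h : (forall phi, `|h phi| <= `|f phi| + `|g phi|) ->
  fbl_bounded f -> fbl_bounded g -> fbl_bounded h.
Proof.
move=> hfg [C fC] [D gD]; exists (C + D) => n phi phiA.
by apply: le_trans (lerD (fC _ _ phiA) (gD _ _ phiA)); rewrite -big_split ler_sum.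
Qed.

Lemma H0D f g : H0 f -> H0 g -> H0 (fun phi => f phi + g phi).
Proof.
move=> [fh /fbl_boundedP fb] [gh /fbl_boundedP gb]; split.
  by move=> l phi psi l0 e; rewrite (fh _ _ _ l0 e) (gh _ _ _ l0 e) mulrDr.
by apply/fbl_boundedP; apply: fbl_boundedW fb gb => phi; exact: ler_normD.
Qed.

Lemma H0Z (a : R) f : H0 f -> H0 (fun phi => a * f phi).
Proof.
move=> [fh /fbl_boundedP[C fC]]; split.
  by move=> l phi psi l0 e; rewrite (fh _ _ _ l0 e) mulrCA.
apply/fbl_boundedP; exists (`|a| * C) => n phi phiA.
by under eq_bigr do rewrite normrM; rewrite -mulr_sumr ler_wpM2l// fC.
Qed.

Lemma H0max f g : H0 f -> H0 g -> H0 (fun phi => Num.max (f phi) (g phi)).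
Proof.
move=> [fh /fbl_boundedP fb] [gh /fbl_boundedP gb]; split.
  by move=> l phi psi l0 e; rewrite (fh _ _ _ l0 e) (gh _ _ _ l0 e) maxr_pMr// ltW.
apply/fbl_boundedP; apply: fbl_boundedW fb gb => phi.
by rewrite /Num.max; case: ifP; rewrite ?lerDl ?lerDr.
Qed.

Section DeltaBound.
Hypothesis nEZ : forall (a : R) x, nE (a *: x) = `|a| * nE x.

(** Scaling by [r^-1] moves [x] into the unit ball. A separate [r > 0] covers vectors with
    [nE x = 0], which cannot be normalized. *)
Lemma admissible_delta_le n (phi : 'I_n -> dualT nE) x r : admissible phi ->
  0 < r -> nE x <= r -> \sum_(k < n) `|sval (phi k) x| <= r.
Proof.
move=> phiA r0 xr.
have /phiA : nE (r^-1 *: x) <= 1.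
  by rewrite nEZ gtr0_norm ?invr_gt0// mulrC ler_pdivrMr// mul1r.
under eq_bigr do rewrite dualZ normrM.
by rewrite -mulr_sumr gtr0_norm ?invr_gt0// mulrC ler_pdivrMr// mul1r.
Qed.

Lemma H0_delta x : H0 (delta (nE := nE) x).
Proof.
split; first by move=> l phi psi l0 e; rewrite /delta e.
apply/fbl_boundedP; exists (`|nE x| + 1) => n phi phiA.
apply: admissible_delta_le => //.
by rewrite (le_trans (ler_norm _))// lerDl.
Qed.

End DeltaBound.

(** * Closure of FBL[E], an intersection of closed sublattices, under the lattice operations *)

Lemma FBL_delta x : FBL nE (delta (nE := nE) x).
Proof. by move=> S []. Qed.

Lemma FBLD f g : FBL nE f -> FBL nE g -> FBL nE (fun phi => f phi + g phi).
Proof.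
by move=> Ff Fg S SS; have [_ _ [SD _] _ _] := SS; apply: SD; [exact: Ff|exact: Fg].
Qed.

Lemma FBLZ (a : R) f : FBL nE f -> FBL nE (fun phi => a * f phi).
Proof. by move=> Ff S SS; have [_ _ [_ SZ] _ _] := SS; apply: SZ; exact: Ff. Qed.

Lemma FBLmax f g : FBL nE f -> FBL nE g ->
  FBL nE (fun phi => Num.max (f phi) (g phi)).
Proof.
by move=> Ff Fg S SS; have [_ _ _ SM _] := SS; apply: SM; [exact: Ff|exact: Fg].
Qed.

Lemma FBLmin f g : FBL nE f -> FBL nE g ->
  FBL nE (fun phi => Num.min (f phi) (g phi)).
Proof.
move=> Ff Fg; have := FBLZ (-1) (FBLmax (FBLZ (-1) Ff) (FBLZ (-1) Fg)).
by congr (FBL nE _); apply/funext => phi; rewrite !mulN1r oppr_max !opprK.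
Qed.

Lemma FBL_abs f : FBL nE f -> FBL nE (fun phi => `|f phi|).
Proof.
move=> Ff; have := FBLmax Ff (FBLZ (-1) Ff).
by congr (FBL nE _); apply/funext => phi; rewrite mulN1r real_maxrN ?num_real.
Qed.

Lemma FBL_abs_delta x : FBL nE (fun phi => `|sval phi x|).
Proof. exact: FBL_abs (FBL_delta x). Qed.

Lemma FBL0 : FBL nE (fun => 0).
Proof.
by have := FBLZ 0 (FBL_delta 0); congr (FBL nE _); apply/funext => phi; rewrite mul0r.
Qed.

Lemma FBL_sum n (F : 'I_n -> dualT nE -> R) : (forall i, FBL nE (F i)) ->
  FBL nE (fun phi => \sum_(i < n) F i phi).
Proof.
elim: n F => [|n IHn] F FF.
  by have := FBL0; congr (FBL nE _); apply/funext => phi; rewrite big_ord0.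
have := FBLD (IHn _ (fun i => FF (widen_ord (leqnSn n) i))) (FF ord_max).
by congr (FBL nE _); apply/funext => phi; rewrite big_ord_recr.
Qed.

(** The functional [C^-1 phi] alone forms an admissible family, and homogeneity scales back. Hence
    norm convergence is uniform on bounded sets of functionals. *)
Lemma pos_hom_le f (C r : R) phi : pos_hom f -> 0 < C ->
  (forall x, `|sval phi x| <= C * nE x) -> (fbl_norm f <= r%:E)%E ->
  `|f phi| <= C * r.
Proof.
move=> fh C0 phiC fr.
have phiA : admissible (fun _ : 'I_1 => dual_scale C^-1 phi).
  move=> x x1; rewrite big_ord1 /= normrM gtr0_norm ?invr_gt0//.
  by rewrite mulrC ler_pdivrMr// mul1r (le_trans (phiC x))// ler_piMr// ltW.
have := le_trans (fbl_norm_ge f phiA) fr; rewrite lee_fin big_ord1.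
rewrite (fh C^-1 phi _ _ _) ?invr_gt0// normrM gtr0_norm ?invr_gt0//.
by rewrite mulrC ler_pdivrMr// mulrC.
Qed.

Definition bounded_weakly_cvg (C : R) (phi_ : nat -> dualT nE) phi :=
  [/\ forall m x, `|sval (phi_ m) x| <= C * nE x,
      forall x, `|sval phi x| <= C * nE x &
      forall x, sval (phi_ m) x @[m --> \oo] --> sval phi x].

(** The functions in [H0] with this convergence form a closed sublattice containing the evaluations;
    norm limits stay inside because they are uniform on the ball of radius [C]. *)
Lemma FBL_cvg f (C : R) (phi_ : nat -> dualT nE) phi :
  (forall (a : R) x, nE (a *: x) = `|a| * nE x) -> 0 < C ->
  bounded_weakly_cvg C phi_ phi -> FBL nE f ->
  f (phi_ m) @[m --> \oo] --> f phi.
Proof.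
move=> nEZ C0 [phi_C phiC phi_cvg].
pose S := [set g | H0 g /\ (g (phi_ m) @[m --> \oo] --> g phi)].
suff SS : closed_sublattice_with_deltas S by move=> /(_ S SS) [].
split.
- by move=> g [].
- by move=> x; split; [exact: H0_delta|exact: phi_cvg].
- split=> [g h [gH gc] [hH hc]|a g [gH gc]].
    by split; [exact: H0D|exact: cvgD].
  by split; [exact: H0Z|exact: cvgMl_tmp].
- move=> g h [gH gc] [hH hc]; split; first exact: H0max.
  apply: continuous2_cvg gc hc.
  exact: (@max_continuous _ R (g phi, h phi)).
move=> g gH gS; split => //; apply/cvgrPdist_lt => e e0.
(* On the ball of radius [C], [pos_hom_le] multiplies the norm by [C], which leaves [e / 3] for each
   of the three errors. *)
have e30 : 0 < e / (3 * C) by rewrite divr_gt0// mulr_gt0.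
have [h [[hH hc] /ltW ghe]] := gS _ e30.
have ghH : pos_hom (fun psi => g psi - h psi).
  have := (H0D gH (H0Z (-1) hH)).1.
  by congr (pos_hom _); apply/funext => psi; rewrite mulN1r.
have gh psi : (forall x, `|sval psi x| <= C * nE x) -> `|g psi - h psi| <= e / 3.
  move=> psiC; have := pos_hom_le ghH C0 psiC ghe.
  by congr (_ <= _); field; rewrite gt_eqF.
have /cvgrPdist_lt/(_ (e / 3)) := hc; rewrite divr_gt0// => /(_ isT).
apply: filterS => m hm.
have := gh _ (phi_C m); have := gh _ phiC; move: hm.
rewrite !ler_norml !ltr_norml => /andP[? ?] /andP[? ?] /andP[? ?].
by apply/andP; split; lra.
Qed.

End FreeBanachLattice.

(** * Dyadic intervals, Rademacher functionals and the Riemann-Lebesgue lemma *)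

Lemma big_ord_double (V : nmodType) (F : nat -> V) k :
  \sum_(i < k.*2) F i = \sum_(i < k) (F i.*2 + F i.*2.+1).
Proof.
elim: k => [|k IHk]; first by rewrite !big_ord0.
by rewrite doubleS !big_ord_recr /= IHk addrA.
Qed.

Section Rademacher.
Context {R : realType}.
Local Notation leb := (@lebesgue_measure R).

(** Half-open, so that the intervals with [i < 2 ^ n] partition [0,1[ exactly. *)
Definition dyadic n i : set (measurableTypeR R) :=
  `[i%:R / 2 ^+ n, i.+1%:R / 2 ^+ n[%classic.

Lemma measurable_dyadic n i : measurable (dyadic n i).
Proof. exact: measurable_itv. Qed.
#[local] Hint Resolve measurable_dyadic : core.

Lemma dyadicP n i t : dyadic n i t <-> i%:R <= t * 2 ^+ n < i.+1%:R.
Proof.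
rewrite /dyadic /= in_itv /= ler_pdivrMr ?exprn_gt0//.
by rewrite ltr_pdivlMr ?exprn_gt0.
Qed.

Lemma dyadic00 : dyadic 0 0 = `[0, 1[%classic.
Proof. by rewrite /dyadic expr0 !divr1. Qed.

Lemma dyadicS n i :
  dyadic n i = dyadic n.+1 i.*2 `|` dyadic n.+1 i.*2.+1.
Proof.
have E (k : nat) : k.*2%:R = k%:R * 2 :> R by rewrite -muln2 natrM.
apply/seteqP; split => t; rewrite /setU /= !dyadicP exprS mulrCA
  -[i.*2.+2%:R]natr1 -[i.*2.+1%:R]natr1 -[i.+1%:R]natr1 E.
  move: (t * 2 ^+ n) => u /andP[iu ui].
  by have [u1|u1] := ltP (2 * u) (i%:R * 2 + 1); [left|right]; apply/andP; split; lra.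
by move: (t * 2 ^+ n) => u [] /andP[iu ui]; apply/andP; split; lra.
Qed.

Lemma dyadicI n i j : i != j -> dyadic n i `&` dyadic n j = set0.
Proof.
wlog ij : i j / (i < j)%N => [H|_].
  by rewrite neq_ltn => /orP[] ij; [|rewrite setIC]; apply: H => //; rewrite ltn_eqF.
apply/seteqP; split => // t [] /dyadicP/andP[_ ti] /dyadicP/andP[tj _].
by have := le_lt_trans tj ti; rewrite ltr_nat ltnS leqNgt ij.
Qed.

Lemma disj_dyadicS n i : [disjoint dyadic n.+1 i.*2 & dyadic n.+1 i.*2.+1].
Proof. by apply/disj_setPS; rewrite dyadicI// ltn_eqF. Qed.

Lemma dyadic_sub n i : (i < 2 ^ n)%N -> dyadic n i `<=` `[0, 1[%classic.
Proof.
move=> i2 t /dyadicP/andP[it ti]; rewrite /= in_itv /=; apply/andP; split.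
  by rewrite -(@pmulr_lge0 _ (2 ^+ n)) ?exprn_gt0// (le_trans _ it).
rewrite -(@ltr_pM2r _ (2 ^+ n)) ?exprn_gt0// mul1r (lt_le_trans ti)//.
by rewrite -natrX ler_nat.
Qed.

Lemma lebesgue_dyadic n i :
  (leb : {measure set (measurableTypeR R) -> \bar R}) (dyadic n i) = (2 ^- n)%:E.
Proof.
rewrite [LHS]lebesgue_measure_itv /= lte_fin.
rewrite ltr_pM2r ?invr_gt0 ?exprn_gt0// ltr_nat leqnn.
by rewrite -EFinD -mulrBl -natr1 addrAC subrr add0r mul1r.
Qed.

Lemma integrable_dyadic n i f : (i < 2 ^ n)%N ->
  leb.-integrable `[0, 1[%classic (EFin \o f) ->
  leb.-integrable (dyadic n i) (EFin \o f).
Proof. by move=> i2; apply: integrableS => //; exact: dyadic_sub. Qed.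

Lemma sum_integral_dyadic n (f : R -> R) :
  leb.-integrable `[0, 1[%classic (EFin \o f) ->
  \sum_(i < 2 ^ n) \int[leb]_(t in dyadic n i) f t =
  \int[leb]_(t in `[0, 1[%classic) f t.
Proof.
move=> fi; elim: n => [|n <-]; first by rewrite big_ord1 dyadic00.
rewrite expnS mul2n (big_ord_double (fun i => \int[leb]_(t in dyadic n.+1 i) f t)).
apply: eq_bigr => i _; rewrite [in RHS]dyadicS Rintegral_setU//.
  by rewrite -dyadicS; exact: integrable_dyadic.
exact: disj_dyadicS.
Qed.

(** The integral of [f r_n] over [0,1[, where [r_n] is the Rademacher function equal to [(-1) ^+ i]
    on the [i]-th interval. For [n = 0] it is the plain integral. *)
Definition rademacher n (f : R -> R) :=
  \sum_(i < 2 ^ n) (-1) ^+ i * \int[leb]_(t in dyadic n i) f t.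

Lemma rademacher_le n (f : R -> R) :
  leb.-integrable `[0, 1[%classic (EFin \o f) ->
  `|rademacher n f| <= \int[leb]_(t in `[0, 1[%classic) `|f t|.
Proof.
move=> fi; rewrite -(@sum_integral_dyadic n (fun t => `|f t|)); last exact: integrable_norm.
apply: le_trans (ler_norm_sum _ _ _) _; apply: ler_sum => i _.
rewrite normrM normrX normrN1 expr1n mul1r; apply: le_normr_Rintegral => //.
exact: integrable_dyadic.
Qed.

Lemma rademacher_linear n (a : R) (f g : R -> R) :
  leb.-integrable `[0, 1[%classic (EFin \o f) ->
  leb.-integrable `[0, 1[%classic (EFin \o g) ->
  rademacher n (fun t => a * f t + g t) = a * rademacher n f + rademacher n g.
Proof.
move=> fi gi; rewrite /rademacher mulr_sumr -big_split; apply: eq_bigr => i _ /=.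
have [fi' gi'] := (integrable_dyadic (ltn_ord i) fi, integrable_dyadic (ltn_ord i) gi).
rewrite RintegralD ?RintegralZl//; first by ring.
exact: (integrableZl (measurable_dyadic n i) a fi').
Qed.

(** Here [c * 2 ^- n] is the integral of the constant [c] over the interval. *)
Lemma dyadic_integral_osc n i (h : R -> R) (c e : R) :
  leb.-integrable (dyadic n i) (EFin \o h) ->
  (forall t, dyadic n i t -> `|h t - c| <= e) ->
  `|\int[leb]_(t in dyadic n i) h t - c * 2 ^- n| <= e * 2 ^- n.
Proof.
move=> hi hc.
have ci (b : R) : leb.-integrable (dyadic n i) (EFin \o cst b).
  apply: measurable_bounded_integrable => //.
    by rewrite [X in (X < _)%E]lebesgue_dyadic ltry.
  by exists `|b|; split => // x bx y _; exact: ltW.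
have E (b : R) : b * 2 ^- n = \int[leb]_(t in dyadic n i) cst b t.
  by rewrite Rintegral_cst// lebesgue_dyadic.
have hci : leb.-integrable (dyadic n i) (EFin \o (fun t => h t - c)).
  exact: (integrableB (measurable_dyadic n i) hi (ci c)).
rewrite !E -RintegralB// (le_trans (le_normr_Rintegral _ hci))//.
by apply: le_Rintegral => //; exact: integrable_norm.
Qed.

(** Heine-Cantor, from the near-covering form of the compactness of [0,1]; only [s] is confined to
    this segment. *)
Lemma unit_interval_uniform (h : R -> R) (e : R) : continuous h -> 0 < e ->
  \forall k \near \oo, forall s t, 0 <= s <= 1 -> `|s - t| < 2 ^- k ->
    `|h t - h s| <= e.
Proof.
move=> hc e0.
have /compact_near_coveringP := @segment_compact R 0 1.
move=> /(_ nat \oo (fun k s => forall t, `|s - t| < 2 ^- k -> `|h t - h s| <= e)).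
move=> cover; apply: filterS (cover _ _) => [k kh s t s01|s _].
  by apply: kh; rewrite /= in_itv.
have e20 : 0 < e / 2 by rewrite divr_gt0.
have /cvgrPdist_lt/(_ _ e20)/nbhs_ballP[d d0 dh] := hc s.
have d20 : 0 < d / 2 by rewrite divr_gt0.
(* With both radii below [d / 2], the centre [u] and the point [t] lie within [d] of [s]. *)
exists (ball s (d / 2), [set k | 2 ^- k < d / 2]) => /=.
  split; first exact: nbhsx_ballx.
  have := near_infty_natSinv_expn_lt (PosNum d20).
  by apply: filterS => k; rewrite div1r.
move=> [u k] /= [su kd] t ut.
have := dh u; have := dh t; rewrite -!ball_normE /=.
have st : `|s - t| < d.
  rewrite -(subrKA u) (le_lt_trans (ler_normD _ _))// (splitr d) ltrD//.
  exact: lt_trans ut _.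
have su' : `|s - u| < d by rewrite (lt_trans su)// ltr_pdivrMr// ltr_pMr// ltr1n.
move=> /(_ st) ht /(_ su') hu.
rewrite -(subrKA (h s)) (le_trans (ler_normD _ _))// (splitr e) lerD// ltW//.
by rewrite distrC.
Qed.

(** The two halves of a dyadic interval carry opposite signs, so on each pair only the oscillation
    of [h] survives. *)
Lemma rademacher_continuous_le (h : R -> R) (e : R) : continuous h -> 0 < e ->
  \forall n \near \oo, `|rademacher n h| <= e.
Proof.
move=> hc e0; have hi : leb.-integrable `[0, 1[%classic (EFin \o h).
  suff : leb.-integrable `[0, 1]%classic (EFin \o h).
    by apply: integrableS => //; apply: subset_itvl; rewrite bnd_simp.
  apply: continuous_compact_integrable; first exact: segment_compact.
  exact: continuous_subspaceT.
have [N _ NP] := unit_interval_uniform hc e0.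
(* Intervals of level [n.+1] pair up into those of level [n], where uniform continuity applies;
   hence the shift to [N.+1]. *)
exists N.+1 => // -[//|n] /= Nn; have {NP}H := NP n Nn.
rewrite /rademacher expnS mul2n
  (big_ord_double (fun i => (-1) ^+ i * \int[leb]_(t in dyadic n.+1 i) h t)).
apply: le_trans (ler_norm_sum _ _ _) _.
have -> : e = \sum_(i < 2 ^ n) e * 2 ^- n.
  by rewrite sumr_const card_ord -[RHS]mulr_natr natrX mulfVK ?expf_neq0.
apply: ler_sum => i _; rewrite exprS -mul2n exprM sqrrN expr1n.
rewrite expr1n mulr1 mulN1r mul1r mul2n.
pose s : R := i%:R / 2 ^+ n.
have s01 : 0 <= s <= 1.
  rewrite divr_ge0 ?exprn_ge0//= ler_pdivrMr ?exprn_gt0// mul1r -natrX ler_nat.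
  exact: ltnW.
have osc t : dyadic n i t -> `|h t - h s| <= e.
  move=> it; apply: H => //; move: it.
  rewrite /dyadic /= in_itv /= -[i.+1%:R]natr1 mulrDl mul1r => /andP[st ts].
  by rewrite distrC ger0_norm ?subr_ge0// ltrBlDl.
have [i2 i21] : (i.*2 < 2 ^ n.+1)%N /\ (i.*2.+1 < 2 ^ n.+1)%N.
  by rewrite expnS mul2n ltn_double ltn_Sdouble.
rewrite dyadicS in osc.
have osc0 := dyadic_integral_osc (integrable_dyadic i2 hi)
  (fun t it => osc t (or_introl it)).
have osc1 := dyadic_integral_osc (integrable_dyadic i21 hi)
  (fun t it => osc t (or_intror it)).
(* Both half-integrals are compared with [h s * 2 ^- n.+1], where [s] is the left endpoint; the two
   errors add up to [e * 2 ^- n]. *)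
rewrite -(subrKA (h s * 2 ^- n.+1)) (le_trans (ler_normD _ _))//.
rewrite [leRHS](_ : _ = e * 2 ^- n.+1 + e * 2 ^- n.+1) ?lerD// 1?distrC//.
by rewrite exprS; field; rewrite expf_neq0.
Qed.

(** Continuous functions are dense in L_1, and [rademacher_le] makes the approximation error uniform
    in [n]. *)
Lemma rademacher_cvg0 (f : R -> R) :
  leb.-integrable `[0, 1[%classic (EFin \o f) ->
  rademacher n f @[n --> \oo] --> 0.
Proof.
move=> fi; apply/cvgr0Pnorm_le => e e0.
have finD : (leb `[0%R, 1%R[%classic < +oo)%E.
  by rewrite lebesgue_measure_itv /= lte_fin ltr01 -EFinB ltry.
have [//|g [gc gi gf]] := approximation_continuous_integrable _ finD fi.
have e20 : 0 < e / 2 by rewrite divr_gt0.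
have [k fgk] : exists k, \int[leb]_(t in `[0, 1[%classic) `|f t - g k t| <= e / 2.
  have /fine_cvg/cvgr0Pnorm_le/(_ _ e20)[k _ /(_ k (leqnn k))] := gf.
  by exists k; exact: le_trans (ler_norm _) _.
apply: filterS (rademacher_continuous_le (gc k) e20) => n gn.
have fgi : leb.-integrable `[0, 1[%classic (EFin \o (fun t => f t - g k t)).
  exact: (integrableB _ fi (gi k)).
have -> : rademacher n f = rademacher n (fun t => f t - g k t) + rademacher n (g k).
  rewrite -[rademacher n (fun t => f t - g k t)]mul1r -rademacher_linear//.
  by congr rademacher; apply/funext => t; rewrite mul1r subrK.
rewrite (le_trans (ler_normD _ _))// (splitr e) lerD//.
exact: le_trans (rademacher_le n fgi) fgk.
Qed.

(** Only the [i]-th term survives. The absolute value [2 ^- n] has the order of the norm of the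
    indicator, which makes the perturbation visible on every dyadic interval. *)
Lemma rademacher_indic n i : (i < 2 ^ n)%N ->
  rademacher n (\1_(dyadic n i)) = (-1) ^+ i * 2 ^- n.
Proof.
move=> i2; have E j : \int[leb]_(t in dyadic n j) \1_(dyadic n i) t =
    fine ((leb : {measure set (measurableTypeR R) -> \bar R}) (dyadic n i `&` dyadic n j)).
  by rewrite /Rintegral integral_indic.
rewrite /rademacher (bigD1 (Ordinal i2)) //= E setIid lebesgue_dyadic.
rewrite big1 ?addr0// => j ji.
by rewrite E dyadicI ?measure0 ?mulr0// eq_sym.
Qed.

End Rademacher.

(** * Dyadic indicators in L_1 and the truncations of |delta_1| *)

Section DyadicL1.
Context {R : realType}.
Local Notation leb := (@lebesgue_measure R).
Local Notation mu := (mu01 R).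
Local Notation dualL1 := (dualT (@L1norm R)).
Implicit Types (x : L1 R).

Lemma L1_integrable x : mu.-integrable setT (EFin \o x).
Proof. by apply/Lfun1_integrable; exact: LfunP. Qed.

Lemma L1normE x : L1norm x = \int[mu]_t `|x t|.
Proof. by rewrite /L1norm Lnorm1. Qed.

Lemma L1normZ (a : R) x : L1norm (a *: x) = `|a| * L1norm x.
Proof.
apply: EFin_inj; rewrite EFinM /L1norm !finite_norm_fine.
exact: LnormZ.
Qed.

(** Restricting Lebesgue measure to [0,1] changes nothing on measurable subsets of [0,1[. *)
Lemma integral_mu01 (f : R -> \bar R) :
  (\int[mu]_(t in `[0%R, 1%R[%classic) f t =
   \int[leb]_(t in `[0%R, 1%R[%classic) f t)%E.
Proof.
apply: eq_measure_integral => A mA A01.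
rewrite /mu01 /= /mrestr setIidl// => t /A01; rewrite /= !in_itv /=.
by move=> /andP[-> /ltW].
Qed.

Lemma L1_integrable_lebesgue x : leb.-integrable `[0, 1[%classic (EFin \o x).
Proof.
have /integrableP[mx xoo] : mu.-integrable `[0, 1[%classic (EFin \o x).
  by apply: integrableS (L1_integrable x).
by apply/integrableP; split => //; rewrite -integral_mu01.
Qed.

Lemma le_L1norm x : \int[leb]_(t in `[0, 1[%classic) `|x t| <= L1norm x.
Proof.
have xi := integrable_norm (L1_integrable x).
rewrite L1normE /Rintegral -integral_mu01 fine_le//.
- by apply: integrable_fin_num => //; apply: integrableS xi.
- exact: integrable_fin_num.
apply: ge0_subset_integral => //.
by have /integrableP[] := xi.
Qed.

(** An inequality, since for arbitrary [i] the interval may stick out of [0,1], where [mu01] has no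
    mass. *)
Lemma integral_mu01_dyadic_le n i :
  (\int[mu]_t `|\1_(dyadic n i) t|%:E <= (2 ^- n)%:E)%E.
Proof.
under eq_integral => t _ do rewrite ger0_norm ?ler0n//.
rewrite integral_indic ?setIT; [|by []|exact: measurable_dyadic].
rewrite -(lebesgue_dyadic n i); apply: le_measure; rewrite ?inE.
- by apply: measurableI; [exact: measurable_dyadic|exact: measurable_itv].
- exact: measurable_dyadic.
- exact: subIsetl.
Qed.

Lemma integrable_dyadic_indic n i :
  mu.-integrable setT (EFin \o \1_(dyadic n i)).
Proof.
apply/integrableP; split.
  by apply/measurable_EFinP; exact: measurable_indic (measurable_dyadic n i).
exact: le_lt_trans (integral_mu01_dyadic_le n i) (ltry (2 ^- n)).
Qed.

Definition dyadicL1 n i : L1 R :=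
  Lfun_Sub (@lexx _ _ 1%E) ((Lfun1_integrable _ _).2 (integrable_dyadic_indic n i)).

(** Elements of [L1] are functions here, and the disjoint half-open halves give the identity at
    every point. *)
Lemma dyadicL1S n i : dyadicL1 n i = dyadicL1 n.+1 i.*2 + dyadicL1 n.+1 i.*2.+1.
Proof.
apply/LfuneqP => t.
have disj : ~ (dyadic n.+1 i.*2 t /\ dyadic n.+1 i.*2.+1 t).
  have := @dyadicI R n.+1 i.*2 i.*2.+1; rewrite ltn_eqF// => /(_ isT).
  by rewrite -subset0; apply.
change (\1_(dyadic n i) t = \1_(dyadic n.+1 i.*2) t + \1_(dyadic n.+1 i.*2.+1) t :> R).
rewrite dyadicS !indicE in_setU.
have [/set_mem t0|] := boolP (t \in dyadic n.+1 i.*2); last by rewrite add0r.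
have [/set_mem t1|] := boolP (t \in dyadic n.+1 i.*2.+1); last by rewrite addr0.
by case: disj.
Qed.

Lemma L1norm_dyadicL1 n i : L1norm (dyadicL1 n i) <= 2 ^- n.
Proof.
rewrite -lee_fin /L1norm finite_norm_fine Lnorm1.
exact: integral_mu01_dyadic_le.
Qed.

Lemma is_dual_rademacher n : is_dual (@L1norm R) (fun x => rademacher n x).
Proof.
split=> [a x y|].
  by rewrite -rademacher_linear//; exact: L1_integrable_lebesgue.
exists 1 => x; rewrite mul1r; apply: le_trans (le_L1norm x).
exact/rademacher_le/L1_integrable_lebesgue.
Qed.

Definition dual_rademacher n : dualL1 := exist _ _ (is_dual_rademacher n).

(** The constant 1 is represented by the indicator of [0,1[, equal to it almost everywhere on
    [0,1]. *)
Definition abs_delta1 (phi : dualL1) := `|sval phi (dyadicL1 0 0)|.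

Definition truncation n (phi : dualL1) :=
  Num.min (abs_delta1 phi)
    (2^-1 * \sum_(i < 2 ^ n) `|sval phi (dyadicL1 n i)|).

Lemma truncation_FBL n : FBL (@L1norm R) (truncation n).
Proof.
apply: FBLmin; first exact: FBL_abs_delta.
by apply: FBLZ; apply: FBL_sum => i; exact: FBL_abs_delta.
Qed.

(** Halving every interval can only increase the sum, by the triangle inequality. *)
Lemma truncation_leS n phi : truncation n phi <= truncation n.+1 phi.
Proof.
rewrite le_min2// ler_wpM2l// expnS mul2n.
rewrite (big_ord_double (fun i => `|sval phi (dyadicL1 n.+1 i)|)).
by apply: ler_sum => i _; rewrite dyadicL1S dualD ler_normD.
Qed.

Lemma truncation_le m n phi : (m <= n)%N -> truncation m phi <= truncation n phi.
Proof.
elim: n => [|n IHn]; first by rewrite leqn0 => /eqP->.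
rewrite leq_eqVlt => /predU1P[->//|/IHn le_mn].
exact: le_trans le_mn (truncation_leS n phi).
Qed.

(** After exchanging the sums, an admissible family gives at most [2 ^- n] at each of the [2 ^ n]
    indicators, so at most 1 before the factor 1/2. *)
Lemma fbl_norm_truncation n : (fbl_norm (truncation n) <= (2^-1)%:E)%E.
Proof.
apply: fbl_norm_le => k phi phiA; rewrite lee_fin.
apply: (@le_trans _ _ (\sum_(j < k) 2^-1 * \sum_(i < 2 ^ n) `|sval (phi j) (dyadicL1 n i)|)).
  apply: ler_sum => j _; rewrite ger0_norm ?ge_min ?lexx ?orbT//.
  by rewrite le_min normr_ge0 mulr_ge0// sumr_ge0.
rewrite -mulr_sumr ler_piMr// exchange_big /=.
rewrite [leRHS](_ : _ = \sum_(i < 2 ^ n) 2 ^- n); last first.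
  by rewrite sumr_const card_ord -[RHS]mulr_natr natrX mulVf ?expf_neq0.
apply: ler_sum => i _; apply: (admissible_delta_le L1normZ phiA).
  by rewrite invr_gt0 exprn_gt0.
exact: L1norm_dyadicL1.
Qed.

(** Tested on the integral functional [dual_rademacher 0], which is admissible and takes the value 1
    at the indicator of [0,1[. *)
Lemma fbl_norm_abs_delta1 : (1 <= fbl_norm abs_delta1)%E.
Proof.
have radA : admissible (fun _ : 'I_1 => dual_rademacher 0).
  move=> x x1; rewrite big_ord1; apply: le_trans x1; apply: le_trans (le_L1norm x).
  exact/rademacher_le/L1_integrable_lebesgue.
apply: le_trans (fbl_norm_ge _ radA); rewrite big_ord1 lee_fin normr_id /=.
by rewrite (rademacher_indic (n := 0) (i := 0))// !expr0 invr1 mul1r normr1.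
Qed.

Lemma truncation_sup (z : dualL1 -> R) : FBL (@L1norm R) z ->
  (forall n, fle (truncation n) z) ->
  fle abs_delta1 z.
Proof.
move=> zF Tz phi; have [_ [C0 phiC0]] := svalP phi.
have L1norm_ge0 x : 0 <= L1norm x by rewrite L1normE Rintegral_ge0.
(* The bound supplied by [is_dual] may be negative. *)
pose C : R := `|C0|.
have phiC x : `|sval phi x| <= C * L1norm x.
  by rewrite (le_trans (phiC0 x))// ler_wpM2r// ler_norm.
pose b : R := abs_delta1 phi.
(* Chosen so that [(M - C) / 2 = b + 1], which exceeds [abs_delta1 (phi_ n)] for large [n]. *)
have [M ME] : exists M, M = C + 2 * (b + 1) by exists (C + 2 * (b + 1)).
have C_ge0 : 0 <= C := normr_ge0 _.
have b_ge0 : 0 <= b := normr_ge0 _.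
have M_ge0 : 0 <= M by rewrite ME; lra.
have K_gt0 : 0 < C + M + 1 by lra.
pose phi_ n := dual_addscale phi M (dual_rademacher n).
have phi_cvg : bounded_weakly_cvg (C + M + 1) phi_ phi.
  split=> [n x|x|x].
  - rewrite (le_trans (ler_normD _ _))// normrM (ger0_norm M_ge0) mulrDl mul1r.
    rewrite -[leLHS]addr0 lerD// mulrDl lerD// ler_wpM2l//.
    apply: le_trans (le_L1norm x).
    exact/rademacher_le/L1_integrable_lebesgue.
  - by rewrite (le_trans (phiC x))// ler_wpM2r// -addrA lerDl addr_ge0.
  rewrite -[X in _ --> X]addr0 -[X in _ --> _ + X](mulr0 M).
  apply: cvgD; first exact: cvg_cst.
  by apply: cvgMl_tmp; exact: rademacher_cvg0 (L1_integrable_lebesgue x).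
have yF : FBL (@L1norm R) abs_delta1 by exact: FBL_abs_delta.
have zc := FBL_cvg L1normZ K_gt0 phi_cvg zF.
have yc := FBL_cvg L1normZ K_gt0 phi_cvg yF.
apply: (ler_cvg_to yc zc).
have /cvgrPdist_lt/(_ 1 ltr01) := yc.
apply: filterS => n; rewrite -/b => ynb.
apply: le_trans (Tz n (phi_ n)).
rewrite le_min lexx /=; have {ynb} : abs_delta1 (phi_ n) <= b + 1.
  by move: ynb; rewrite ltr_norml => /andP[yb _]; lra.
move=> /le_trans; apply; rewrite ler_pdivlMl//.
(* Equal shares over the intervals: on each indicator the Rademacher part has size [M * 2 ^- n] and
   [phi] at most [C * 2 ^- n]. *)
have -> : 2 * (b + 1) = \sum_(i < 2 ^ n) (M - C) * 2 ^- n.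
  rewrite sumr_const card_ord -[RHS]mulr_natr natrX mulfVK ?expf_neq0//.
  by rewrite ME addrAC subrr add0r.
apply: ler_sum => i _ /=; rewrite mulrBl [in leRHS]addrC rademacher_indic//.
apply: le_trans (lerB_normD _ _).
rewrite normrM (ger0_norm M_ge0) normrM normrX normrN1 expr1n mul1r.
rewrite ger0_norm ?invr_ge0 ?exprn_ge0// lerB// (le_trans (phiC _))//.
by rewrite ler_wpM2l// L1norm_dyadicL1.
Qed.

End DyadicL1.

Theorem theorem4p13 (R : realType) :
  exists F : set (dualT (@L1norm R) -> R),
    [/\ F `<=` FBL (@L1norm R),
        (forall f, F f -> fle (fun _ => 0) f),
        F !=set0,
        (forall f g, F f -> F g -> exists h, [/\ F h, fle f h & fle g h]) &
        exists y, [/\ FBL (@L1norm R) y,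
                      (forall f, F f -> fle f y),
                      (forall z, FBL (@L1norm R) z ->
                         (forall f, F f -> fle f z) -> fle y z) &
                      ereal_sup [set fbl_norm f | f in F] <> fbl_norm y]].
Proof.
exists [set truncation n | n in setT]; split.
- by move=> _ [n _ <-]; exact: truncation_FBL.
- move=> _ [n _ <-] phi.
  by rewrite /truncation le_min normr_ge0 mulr_ge0// sumr_ge0.
- by exists (truncation 0); exists 0%N.
- move=> _ _ [m _ <-] [n _ <-]; exists (truncation (maxn m n)); split.
  + by exists (maxn m n).
  + by move=> phi; rewrite truncation_le// leq_maxl.
  + by move=> phi; rewrite truncation_le// leq_maxr.
exists abs_delta1; split.
- exact: FBL_abs_delta.
- by move=> _ [n _ <-] phi; rewrite /truncation ge_min lexx.
- by move=> z zF Fz; apply: truncation_sup => // n; apply: Fz; exists n.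
(* Equality would force the supremum, at most 1/2, to be at least 1. *)
move=> sup_eq; have := @fbl_norm_abs_delta1 R; rewrite -sup_eq leNgt => /negP; apply.
apply: (@le_lt_trans _ _ (2^-1)%:E); last by rewrite lte_fin invf_lt1// ltr1n.
by apply: ge_ereal_sup => _ [_ [n _ <-] <-]; exact: fbl_norm_truncation.
Qed.
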